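(* Let $(X,\mathsf d,\mathfrak m)$ be a metric measure space and let $s>1$. Assume that $(X,\mathsf d,\mathfrak m)$ is uniformly lower $s$-Ahlfors regular, that $\mathfrak m$ is uniformly locally doubling, and that $(X,\mathsf d,\mathfrak m)$ satisfies a weak local $(1,1)$ non-averaged Poincaré inequality. Then there exist constants $C>0$ and $v>0$ such that for every set of finite perimeter $E\subset X$ the following implication holds: $$\mathfrak m(E)\le v\quad\Longrightarrow\quad \mathfrak m(E)^{(s-1)/s}\le C\,P(E).$$
   Context: A metric measure space $(X,\mathsf d,\mathfrak m)$ is a complete separable metric space with a nonnegative Borel measure finite on bounded sets; $B_r(x)$ is the open ball. Perimeter: for $u$ locally Lipschitz, $\mathrm{lip}\,u(x)=\limsup_{y\to x}|u(y)-u(x)|/\mathsf d(x,y)$ ($0$ at isolated points). For $E\subset X$ Borel, $P(E)=\inf\{\liminf_i\int_X \mathrm{lip}\,u_i\,d\mathfrak m: u_i\in \mathrm{Lip}_{loc}(X),\ u_i\to\chi_E \text{ in } L^1_{loc}(X,\mathfrak m)\}$; $E$ has finite perimeter if $P(E)<\infty$. Uniformly lower $s$-Ahlfors regular: there exist $R>0$ and $C>0$ such that $\mathfrak m(B_r(x))\ge Cr^s$ for every $x\in X$ and $r\in(0,R]$. Uniformly locally doubling: for every $R>0$ there is $C>0$ with $\mathfrak m(B_{2r}(x))\le C\,\mathfrak m(B_r(x))$ for all $x\in X$, $r\le R$. Weak local $(1,1)$ non-averaged Poincaré inequality: there exists $\lambda\ge1$ such that for every $R>0$ there is $C_P>0$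 such that for every $f\in L^1_{loc}(X,\mathfrak m)$ and every upper gradient $g$ of $f$, $\int_{B_r(x)}|f-\bar f(x)|\,d\mathfrak m\le C_P\,r\int_{B_{\lambda r}(x)}g\,d\mathfrak m$ for all $x\in X$ and $r<R$, where $\bar f(x)=\frac{1}{\mathfrak m(B_r(x))}\int_{B_r(x)}f\,d\mathfrak m$. *)

(* Defs.v *)
From HB Require Import structures.
From mathcomp Require Import all_boot all_order all_algebra.
From mathcomp Require Import all_classical all_reals all_analysis.
From mathcomp Require Import measurable_realfun.

Set Implicit Arguments.
Unset Strict Implicit.
Unset Printing Implicit Defensive.

Import Order.TTheory GRing.Theory Num.Theory.
Import numFieldNormedType.Exports.

Local Open Scope classical_set_scope.
Local Open Scope ring_scope.
Local Open Scope ereal_scope.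

(* The library's [Complete] structure is pointed, so these spaces are
   nonempty. *)
#[short(type="completeMetricType")]
HB.structure Definition CompleteMetric (R : realType) :=
  { T of CompletePseudoMetric R T & Metric R T }.

Notation borel X := (g_sigma_algebraType (@open X)).

Definition separable_space (X : topologicalType) :=
  exists2 D : set X, countable D & dense D.

Section metric_functions.
Context {R : realType} {X : completeMetricType R}.
Implicit Types (u f : X -> R) (g : X -> \bar R) (A : set X).

Definition bounded_subset A := exists (x : X) (r : R), A `<=` ball x r.

Definition locally_lipschitz u := forall x : X,
  exists r L : R, (0 < r)%R /\
    forall y z, ball x r y -> ball x r z -> (`|u y - u z| <= L * mdist y z)%R.

(* At an isolated point the punctured neighborhood filter x^' contains set0 and
   limf_esup would be -oo. *)
Definition lip u (x : X) : \bar R :=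
  if `[< isolated [set: X] x >] then 0
  else limf_esup (fun y => (`|u y - u x| / mdist x y)%:E) x^'.

Definition curve_variation (c : R -> X) (a b : R) (s : seq R) : R :=
  let F := c \o nth b (a :: s) in
  (\sum_(0 <= n < size s) mdist (F n) (F n.+1))%R.

Definition curve_length (c : R -> X) (a b : R) : \bar R :=
  ereal_sup [set (curve_variation c a b s)%:E | s in itv_partition a b].

(* Every rectifiable curve has such a parametrization c over [0, L], and the line
   integral of g along it is by definition the integral of g \o c over [0, L].
   Continuity of c on [0, L] is automatic, since c is 1-Lipschitz there. *)
Definition arclength_parametrized (c : R -> X) (L : R) :=
  forall a b : R, (0 <= a)%R -> (a <= b)%R -> (b <= L)%R ->
    curve_length c a b = (b - a)%:E.

Definition upper_gradient f g :=
  [/\ measurable_fun [set: borel X] (g : borel X -> \bar R),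
      forall x, 0 <= g x &
      forall (c : R -> X) (L : R), (0 <= L)%R -> arclength_parametrized c L ->
        `|f (c L) - f (c 0%R)|%:E <=
          \int[lebesgue_measure]_(t in `[0%R, L]) g (c t)].

End metric_functions.

Section metric_measure_spaces.
Context {R : realType} {X : completeMetricType R}.
Variable mu : {measure set (borel X) -> \bar R}.
Implicit Types (u f : X -> R) (E : set X).

Definition metric_measure_space :=
  separable_space X /\
  forall A : set (borel X), measurable A -> bounded_subset (A : set X) ->
    mu A < +oo.

(* L^1_loc and convergence in it are local at each point, i.e. tested on some
   neighborhood of each point. *)
Definition L1loc f :=
  measurable_fun [set: borel X] (f : borel X -> R) /\
  forall x : X, exists2 r : R, (0 < r)%R &
    mu.-integrable (ball x r : set (borel X)) (EFin \o f).

Definition cvg_L1loc (u_ : nat -> X -> R) f := forall x : X,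
  exists2 r : R, (0 < r)%R &
    \int[mu]_(y in (ball x r : set (borel X))) `|u_ i y - f y|%:E
      @[i --> \oo] --> 0.

Definition perimeter E : \bar R :=
  ereal_inf [set p | exists u_ : nat -> X -> R,
    [/\ forall i, locally_lipschitz (u_ i),
        cvg_L1loc u_ (\1_E) &
        p = limn_einf (fun i => \int[mu]_(x in [set: borel X]) lip (u_ i) x)]].

Definition finite_perimeter E :=
  measurable (E : set (borel X)) /\ perimeter E < +oo.

Definition uniformly_lower_Ahlfors_regular (s : R) :=
  exists rho C : R, [/\ (0 < rho)%R, (0 < C)%R &
    forall (x : X) (r : R), (0 < r)%R -> (r <= rho)%R ->
      (C * r `^ s)%:E <= mu (ball x r)].

Definition uniformly_locally_doubling :=
  forall rho : R, (0 < rho)%R -> exists2 C : R, (0 < C)%R &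
    forall (x : X) (r : R), (0 < r)%R -> (r <= rho)%R ->
      mu (ball x (2 * r)%R) <= C%:E * mu (ball x r).

Definition ball_average f (x : X) (r : R) : R :=
  ((fine (mu (ball x r)))^-1 * Rintegral mu (ball x r) f)%R.

Definition weak_local_poincare :=
  exists2 lambda : R, (1 <= lambda)%R &
  forall rho : R, (0 < rho)%R -> exists2 CP : R, (0 < CP)%R &
  forall (f : X -> R) (g : X -> \bar R), L1loc f -> upper_gradient f g ->
  forall (x : X) (r : R), (0 < r)%R -> (r < rho)%R ->
    \int[mu]_(y in (ball x r : set (borel X))) `|f y - ball_average f x r|%:E <=
      (CP * r)%:E *
      \int[mu]_(y in (ball x (lambda * r)%R : set (borel X))) g y.

End metric_measure_spaces.

(* Main.v *)
Require Import Defs.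
From HB Require Import structures.
From mathcomp Require Import all_boot all_order all_algebra.
From mathcomp Require Import all_classical all_reals all_analysis.
From mathcomp Require Import measurable_realfun.
From mathcomp Require Import lra ring.

Set Implicit Arguments.
Unset Strict Implicit.
Unset Printing Implicit Defensive.

Import Order.TTheory GRing.Theory Num.Theory.
Import numFieldNormedType.Exports.

Local Open Scope classical_set_scope.
Local Open Scope ring_scope.
Local Open Scope ereal_scope.

(** The proof is one covering argument, run for a single approximating function.

    Let u be a locally Lipschitz function that is close to the indicator of E in
    L^1 on a large ball V and whose slope has integral at most P(E) plus a small
    error.  Put U = {u > 1/2}: this is open and differs from E, inside V, by a
    set of small measure.  Take x in E, U and V, and look at the density of E in
    the balls of radius rho / 2^k about x.  At the top scale the density is below
    a small constant c, because mu(E) is small and balls of radius rho have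
    measure bounded below.  Two cases remain.

    - The density reaches c at some scale.  Just before the first such scale,
      the density in the ball B of radius r lies between a constant multiple of
      c and 1/2.  The Poincare inequality for u then gives
      mu(E \cap B) <= int_B |u - 1_E| + C r int_(lambda B) lip u
      ([relative_isoperimetric]), and lower regularity gives
      r <= C mu(E)^(1/s) ([isoperimetric_scale]).
    - The density stays below c at every scale.  Choosing a ball B contained in
      U and V, doubling gives mu(E \cap 3B) <= 1/2 mu(B), so these points account
      for at most half of the measure of U in V.  This takes the place of the
      Lebesgue density theorem, and U takes the place of an open neighbourhood
      provided by outer regularity.

    In both cases mu(E \cap 3B') is at most the integral over B' of one fixed
    function phi, where B' is B or lambda B; a Vitali selection of disjoint balls
    turns this into mu(E \cap U \cap V) <= int phi ([covering_comparison]), and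
    absorbing the term 1/2 mu(U \cap V) leaves
    mu(E \cap V) <= error + C mu(E)^(1/s) int lip u
    ([localized_isoperimetric_estimate]).  The theorem follows by letting the
    error tend to 0 and V increase to X.

    Two facts have to be supplied for this.  The slope of a locally Lipschitz
    function is a Borel upper gradient ([lip_upper_gradient]), so that the
    Poincare inequality applies to u; and convergence near every point implies
    convergence in L^1 on every ball ([cvg_L1loc_ball]), because lower regularity
    makes bounded sets totally bounded, hence relatively compact. *)

(** * Coverings by balls *)

(** Vitali covering.  A family is called admissible when a ball of the cover that
    meets it also meets one of its members of at least half the radius; this
    property passes to unions of chains, so Zorn's lemma gives a maximal
    admissible family.  A ball meeting none of its members could be added,
    provided that its radius is more than half the supremum of the radii of such
    balls.  The factor 3 suffices because only the centres have to be covered: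
    two balls that meet have centres closer than the sum of their radii. *)
Lemma vitali_covering_radii (R : realType) (X : pseudoMetricType R)
    (A : set X) (r : X -> R) (M : R) :
  (forall x, A x -> 0 < r x <= M)%R ->
  exists D : set X, [/\ D `<=` A,
    trivIset D (fun x => ball x (r x)) &
    A `<=` \bigcup_(y in D) ball y (3 * r y)].
Proof.
move=> r0.
pose meet x y := ball x (r x) `&` ball y (r y) !=set0.
have meet_sym x y : meet x y -> meet y x by rewrite /meet setIC.
pose P (G : set X) := [/\ G `<=` A, trivIset G (fun x => ball x (r x)) &
  forall x, A x -> (exists2 g, G g & meet x g) ->
            exists2 g, G g & meet x g /\ (r x <= 2 * r g)%R].
have [|G [[GA tG Gmeet] Gmax]] := @Zorn_bigcup X P.
  move=> F FP totF; split.
  - by move=> x [G FG Gx]; have [+ _ _] := FP _ FG; exact.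
  - move=> x y [G FG Gx] [H FH Hy] xy.
    have [GH|HG] := totF _ _ FG FH.
      by have [_ + _] := FP _ FH; apply => //; exact: GH.
    by have [_ + _] := FP _ FG; apply => //; exact: HG.
  - move=> x Ax [g [G FG Gg] xg].
    have [_ _ /(_ _ Ax)] := FP _ FG.
    by case=> [|h Gh xh]; [exists g|exists h => //; exists G].
exists G; split=> // x Ax.
have [/(Gmeet _ Ax)[g Gg [[z [xz gz]] rxg]]|nomeet] :=
    pselect (exists2 g, G g & meet x g).
  exists g => //.
  apply: (@le_ball _ _ g (r g + r x)%R); first lra.
  by apply: ball_triangle gz _; exact: ball_sym.
pose B := [set y | A y /\ ~ exists2 g, G g & meet y g].
have supB : has_sup (r @` B).
  split; first by exists (r x), x.
  by exists M => _ [y [Ay _] <-]; have /andP[] := r0 _ Ay.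
have rx0 : (0 < r x)%R by have /andP[] := r0 _ Ax.
have rxS : (r x <= sup (r @` B))%R by apply: ub_le_sup; [case: supB|exists x].
have S0 : (0 < sup (r @` B) / 2)%R by lra.
have [_ [y [Ay yG] <-] Sy] := sup_adherent S0 supB.
exfalso; apply: (Gmax (G `|` [set y])).
  split; first by move=> z; left.
  move=> /(_ y (or_intror erefl)) Gy; apply: yG; exists y => //; exists y; split;
  by apply: ballxx; have /andP[] := r0 _ Ay.
split.
- by move=> z [/GA //|->].
- move=> a b [Ga|->] [Gb|->] // ab; first exact: tG ab.
    by exfalso; apply: yG; exists a => //; exact: meet_sym.
  by exfalso; apply: yG; exists b.
- move=> z Az [g Gyg zg].
  have [/(Gmeet _ Az)[h Gh zh]|zG] := pselect (exists2 g, G g & meet z g).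
    by exists h => //; left.
  case: Gyg => [Gg|gy]; first by exfalso; apply: zG; exists g.
  exists g; first by right.
  split=> //; rewrite gy.
  have : (r z <= sup (r @` B))%R by apply: ub_le_sup; [case: supB|exists z].
  lra.
Qed.

(** Each member contains a point of a countable dense set, and disjointness makes
    the choice of such a point injective. *)
Lemma countable_disjoint_open (T : ptopologicalType) (I : choiceType) (D : set I)
    (F : I -> set T) :
  separable_space T -> (forall i, D i -> open (F i) /\ F i !=set0) ->
  trivIset D F -> countable D.
Proof.
move=> [Q cQ dQ] DF tF.
have /choice[q qP] : forall i, exists x, D i -> Q x /\ F i x.
  move=> i; have [Di|nDi] := pselect (D i); last first.
    by exists point.
  have [oF F0] := DF _ Di.
  by have [x [Fx Qx]] := dQ _ F0 oF; exists x.
apply: sub_countable cQ.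
have eqD : (D #= q @` D)%card.
  rewrite card_eq_sym; apply: inj_card_eq => i j /set_mem Di /set_mem Dj qij.
  apply: tF => //; exists (q i); split; first exact: (qP _ Di).2.
  by rewrite qij; exact: (qP _ Dj).2.
rewrite (card_le_eql eqD).
by apply: subset_card_le => _ [i Di <-]; exact: (qP _ Di).1.
Qed.

Section borel_sets.
Context {R : realType} {X : completeMetricType R}.
Implicit Types (u : X -> R) (U : set X).

Lemma open_borel U : open U -> measurable (U : set (borel X)).
Proof. by move=> oU; apply: sub_sigma_algebra. Qed.

Lemma open_metric_ball (x : X) (r : R) : open (ball x r).
Proof.
rewrite openE => y; rewrite ballEmdist /= => xy.
apply/nbhs_ballP; exists (r - mdist x y)%R; rewrite /= ?subr_gt0// => z.
rewrite !ballEmdist /= => yz.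
have := metric_triangle x y z; lra.
Qed.

Lemma ball_borel (x : X) (r : R) : measurable (ball x r : set (borel X)).
Proof. by apply: open_borel; exact: open_metric_ball. Qed.

End borel_sets.

Section covering_comparison.
Context {R : realType} {X : completeMetricType R}.
Variable mu : {measure set (borel X) -> \bar R}.

(** This is how local inequalities between two set functions become global: the
    selected balls B(x, r) are disjoint, so the integrals of phi over them add up
    to at most its total integral, while the balls B(x, 3r) cover A. *)
Lemma covering_comparison (A : set X) (phi : X -> \bar R) (r : X -> R) (M : R) :
  separable_space X -> measurable (A : set (borel X)) ->
  measurable_fun [set: borel X] (phi : borel X -> \bar R) ->
  (forall x, 0 <= phi x) ->
  (forall x, A x -> 0 < r x <= M)%R ->
  (forall x, A x -> mu (A `&` ball x (3 * r x)) <=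
                    \int[mu]_(y in (ball x (r x) : set (borel X))) phi y) ->
  mu A <= \int[mu]_(x in [set: borel X]) phi x.
Proof.
move=> sX mA mphi phi0 rM Aphi.
have [D [DA tD AD]] := vitali_covering_radii rM.
have r0 x : D x -> (0 < r x)%R by move=> /DA /rM /andP[].
have cD : countable D.
  apply: (countable_disjoint_open sX _ tD) => x Dx; split.
    exact: open_metric_ball.
  by exists x; apply: ballxx; exact: r0.
have /countable_injP[f] := cD.
move=> finj.
(* Each of these unions has at most one term, f being injective on D; they index
   the selected balls by the natural numbers. *)
pose F n := \bigcup_(x in D `&` f @^-1` [set n]) ball x (r x).
pose G n := \bigcup_(x in D `&` f @^-1` [set n]) ball x (3 * r x)%R.
have mF n : measurable (F n : set (borel X)).
  by apply: open_borel; apply: bigcup_open => x _; exact: open_metric_ball.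
have mG n : measurable (G n : set (borel X)).
  by apply: open_borel; apply: bigcup_open => x _; exact: open_metric_ball.
have tF : trivIset setT F.
  move=> m n _ _ [z [[x [Dx fx] xz] [y [Dy fy] yz]]].
  rewrite /= in fx fy; rewrite -fx -fy; congr f.
  by apply: tD => //; exists z.
have Asub : A `<=` \bigcup_n (A `&` G n).
  move=> x Ax; have [y Dy xy] := AD _ Ax.
  by exists (f y) => //; split=> //; exists y.
have AFG n : mu (A `&` G n) <= \int[mu]_(x in (F n : set (borel X))) phi x.
  have [[x [Dx fx]]|noD] := pselect (exists x, D x /\ f x = n); last first.
    rewrite (_ : G n = set0) ?setI0 ?measure0; first exact: integral_ge0.
    by rewrite -subset0 => z [x [Dx fx] _]; apply: noD; exists x.
  have DfE : D `&` f @^-1` [set n] = [set x].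
    apply/seteqP; split=> [y [Dy fy]|y ->] //=.
    by apply: finj; rewrite ?inE// fx.
  rewrite /F /G DfE !bigcup_set1.
  exact/Aphi/DA.
apply: (@le_trans _ _ (\sum_(n <oo) mu (A `&` G n))).
  apply: measure_sigma_subadditive => //.
  by move=> n; exact: measurableI.
apply: (@le_trans _ _ (\sum_(n <oo) \int[mu]_(x in (F n : set (borel X))) phi x)).
  by apply: lee_nneseries => // n _ _; exact: measure_ge0.
rewrite -ge0_integral_bigcup //; last exact: measurable_funTS.
apply: ge0_subset_integral => //; first exact: bigcup_measurable.
Qed.

End covering_comparison.

(** * The slope of a locally Lipschitz function *)

Section slope.
Context {R : realType} {X : completeMetricType R}.
Implicit Types (u : X -> R) (x y : X).

Lemma locally_lipschitz_continuous u : locally_lipschitz u -> continuous u.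
Proof.
move=> uL x; have [r [L [r0 uLx]]] := uL x.
apply/cvgrPdist_lt => e e0.
apply/nbhs_ballP; exists (Num.min r (e / (`|L| + 1)))%R => /=.
  by rewrite lt_min r0 divr_gt0.
move=> y; rewrite ballEmdist /= lt_min => /andP[xyr xye].
apply: (le_lt_trans (uLx _ _ _ _)); rewrite ?ballEmdist /= ?mdistxx//.
apply: (@le_lt_trans _ _ (`|L| * mdist x y)%R).
  by rewrite ler_wpM2r ?mdist_ge0 ?ler_norm.
rewrite ltr_pdivlMr in xye; last by rewrite ltr_wpDl.
have := @mdist_ge0 _ _ x y; nra.
Qed.

Lemma continuous_borel u : continuous u ->
  measurable_fun [set: borel X] (u : borel X -> R).
Proof.
move=> cu; apply: (measurability _ (RGenOpens.measurableE R)).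
move=> _ [_ [a [b ->] <-]]; rewrite setTI; apply: open_borel.
by apply: open_comp => [x _|]; [exact: cu|exact: interval_open].
Qed.

Lemma dnbhs_set0_isolated x : x^' set0 -> isolated [set: X] x.
Proof.
move=> x0; split; first exact: in_setT.
exists [set x]; last by rewrite setIT.
move: x0; rewrite /dnbhs /within /=; apply: filterS => y /= yx.
by have [//|/yx] := eqVneq y x.
Qed.

Lemma lip_ge0 u x : 0 <= lip u x.
Proof.
rewrite /lip; case: asboolP => // xi.
apply: limf_esup_ge0 => [/dnbhs_set0_isolated//|y].
by rewrite lee_fin divr_ge0// mdist_ge0.
Qed.

(** A description of the strict sublevel sets of the slope that is the same at
    isolated and at non-isolated points. *)
Lemma lip_ltP u x (a : R) : (0 < a)%R ->
  lip u x < a%:E <-> exists b r : R, [/\ (0 <= b < a)%R, (0 < r)%R &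
    forall y, ball x r y -> (`|u y - u x| <= b * mdist x y)%R].
Proof.
move=> a0; rewrite /lip; case: asboolP => [[_ [V xV]]|xi].
  rewrite setIT => Vx; split=> // _.
  move/nbhs_ballP : xV => [r /= r0 rV].
  exists 0%R, r; split; rewrite ?lexx//= => y /rV.
  by rewrite Vx => ->; rewrite subrr normr0 mul0r.
split.
- move=> /ereal_inf_lt[_ [V xV <-] Va].
  have /nbhs_ballP[r /= r0 rV] := xV.
  pose S := ereal_sup [set (`|u y - u x| / mdist x y)%:E | y in V].
  have S0 : 0 <= S.
    have [V0|/set0P[y Vy]] := eqVneq V set0.
      by exfalso; apply/xi/dnbhs_set0_isolated; rewrite -V0.
    apply: le_ereal_sup_tmp; exists (`|u y - u x| / mdist x y)%:E.
      by exists y.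
    by rewrite lee_fin divr_ge0// mdist_ge0.
  have Sfin : S \is a fin_num.
    by rewrite ge0_fin_numE//; apply: lt_trans Va _; rewrite ltry.
  exists (fine S), r; split => //.
    by rewrite fine_ge0//= -lte_fin fineK.
  move=> y xy; have [->|yx] := eqVneq y x.
    by rewrite subrr normr0 mulr_ge0 ?mdist_ge0 ?fine_ge0.
  rewrite -ler_pdivrMr ?mdist_gt0 1?eq_sym//.
  rewrite -lee_fin fineK//; apply: ereal_sup_ubound; exists y => //.
  exact: rV.
- move=> [b [r [/andP[b0 ba] r0 ub]]].
  apply: (@le_lt_trans _ _ b%:E); last by rewrite lte_fin.
  apply: ereal_inf_le.
  exists (ereal_sup [set (`|u y - u x| / mdist x y)%:E | y in ball x r `\ x]).
    by exists (ball x r `\ x) => //; exact: dnbhs_ball.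
  apply: ge_ereal_sup => _ [y [xy /eqP yx] <-].
  by rewrite lee_fin ler_pdivrMr ?mdist_gt0 1?eq_sym//; exact: ub.
Qed.

Lemma exists_natSinv_lt (e : R) : (0 < e)%R -> exists n : nat, (n.+1%:R^-1 < e)%R.
Proof.
by move=> e0; have [N _ /(_ N (leqnn N))] := near_infty_natSinv_lt (PosNum e0); exists N.
Qed.

(** By [lip_ltP] a strict sublevel set of the slope is a countable union of the
    sets C k n below, where the radius is 1 / (n + 1) and the bound is the fraction
    k / (k + 1) of the level.  Each of them is closed, since its defining
    inequalities fail on open sets. *)
Lemma measurable_lip u : continuous u ->
  measurable_fun [set: borel X] (lip u : borel X -> \bar R).
Proof.
move=> cu; apply: (measurability _ (ErealGenInftyO.measurableE R)).
move=> _ [_ [a ->] <-]; rewrite setTI.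
have [a0|a0] := leP a 0%R.
  rewrite (_ : _ @^-1` _ = set0) // -subset0 => x /=.
  rewrite in_itv /= ltNge => /negP; apply; apply: le_trans (lip_ge0 u x).
  by rewrite lee_fin.
pose C (k n : nat) := [set x | forall y, ball x n.+1%:R^-1 y ->
  (`|u y - u x| <= a * k%:R / k.+1%:R * mdist x y)%R].
rewrite (_ : _ @^-1` _ = \bigcup_k \bigcup_n C k n).
  apply: bigcup_measurable => k _; apply: bigcup_measurable => n _.
  rewrite -(setCK (C k n)); apply: measurableC; apply: open_borel.
  set b := (a * k%:R / k.+1%:R)%R.
  rewrite openE => x /=; rewrite -existsNE => -[y].
  rewrite not_implyE => -[xy /negP]; rewrite -ltNge => uxy.
  pose w z := (`|u y - u z| - b * mdist z y)%R.
  have cd : continuous (fun z => mdist z y).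
    move=> z; apply/cvgrPdist_lt => e e0.
    apply/nbhs_ballP; exists e => //= t; rewrite ballEmdist /= => zt.
    have := metric_triangle z t y; have := metric_triangle t z y.
    rewrite (metric_sym t z) => h1 h2; rewrite ltr_norml; lra.
  have cw : continuous w.
    move=> z; apply: cvgB.
      by apply: cvg_norm; apply: cvgB; [exact: cvg_cst|exact: cu].
    by apply: cvgM; [exact: cvg_cst|exact: cd].
  have w0 : (0 < w x)%R by rewrite subr_gt0.
  have w_near : \forall z \near x, (0 < w z)%R by apply: (cvgr_gt (w x) (cw x)).
  have xy_near : \forall z \near x, ball z n.+1%:R^-1 y.
    have : nbhs x (ball y n.+1%:R^-1).
      by apply: open_nbhs_nbhs; split; [exact: open_metric_ball|exact: ball_sym].
    by apply: filterS => z /ball_sym.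
  apply: filterS2 xy_near w_near => z zy wz Cz.
  by have := Cz _ zy; rewrite leNgt -subr_gt0 wz.
apply/seteqP; split => x /=; rewrite in_itv /=.
- move/(lip_ltP _ _ a0) => [b [r [/andP[b0 ba] r0 ub]]].
  have [n nr] : exists n : nat, (n.+1%:R^-1 < r)%R.
    exact: exists_natSinv_lt.
  have [k kb] : exists k : nat, (k.+1%:R^-1 < (a - b) / a)%R.
    by apply: exists_natSinv_lt; rewrite divr_gt0 ?subr_gt0.
  exists k => //; exists n => // y xy.
  apply: le_trans (ub _ _) _; first by apply: le_ball xy; exact: ltW.
  rewrite ler_wpM2r ?mdist_ge0//.
  rewrite -addn1 natrD in kb *.
  move: kb; set K : R := k%:R; have K0 : (0 <= K)%R by rewrite ler0n.
  rewrite ltr_pdivlMr// mulrC ltr_pdivrMr ?ltr_wpDl// => kb.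
  rewrite ler_pdivlMr ?ltr_wpDl//; nra.
- move=> [k _ [n _ Cx]]; apply/(lip_ltP _ _ a0).
  exists (a * k%:R / k.+1%:R)%R, (n.+1%:R^-1)%R; split => //.
  rewrite divr_ge0 ?mulr_ge0 ?(ltW a0)//= ltr_pdivrMr// ltr_pM2l//.
  by rewrite ltr_nat.
Qed.

End slope.

(** * Increments on a segment *)

Section difference_quotients.
Local Open Scope ring_scope.
Context {R : realType}.
Implicit Types (h : R -> R) (G : R -> \bar R) (L : R).
Notation leb := (@lebesgue_measure R).

(** With F a primitive of h, the difference quotient of h is the derivative of the
    difference quotient of F, so its integral is a difference of two difference
    quotients of F, at L and at 0; these tend to h L and h 0. *)
Lemma integral_difference_quotient_cvg h L (d : R^nat) :
  continuous h -> (0 < L)%R -> (forall n, 0 < d n <= 1)%R -> d @ \oo --> 0%R ->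
  (\int[leb]_(t in `[0%R, L]) ((h (t + d n) - h t) / d n)%:E)%E @[n --> \oo]
    --> (h L - h 0)%:E.
Proof.
move=> ch L0 d01 d0.
(* The lower end -1 and the upper end L + 2 keep the points of [0, L + 1] in the
   interior of the interval on which F is a primitive of h. *)
pose F x := (\int[leb]_(t in `[(-1)%R, x]) h t)%R.
have F' x : (-1 < x < L + 2)%R -> is_derive x 1 F (h x).
  move=> /andP[x1 xL].
  have [|dF F'E] := @continuous_FTC1_closed _ h (-1) x (L + 2) xL _ x1 (ch x).
    apply: continuous_compact_integrable; first exact: segment_compact.
    by apply: continuous_subspaceT => y; exact: ch.
  by split; [exact: dF|rewrite -derive1E].
have qE n : (\int[leb]_(t in `[0%R, L]) ((h (t + d n) - h t) / d n)%:E)%E =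
    ((F (L + d n) - F L) / d n - (F (0 + d n) - F 0) / d n)%:E.
  pose Phi t := ((d n)^-1 * (F (t + d n) - F t))%R.
  have /andP[dn0 dn1] := d01 n.
  have Phi' t : (-1 < t < L + 1)%R ->
      is_derive t 1 Phi ((d n)^-1 * (h (t + d n) - h t))%R.
    move=> /andP[t1 tL].
    have tdn : is_derive (t + d n)%R 1 F (h (t + d n)) by apply: F'; lra.
    have Ft : is_derive t 1 F (h t) by apply: F'; lra.
    have sh : is_derive t 1%R (fun x => x + d n)%R 1%R.
      by apply: is_derive_eq; rewrite addr0.
    have Fsh : is_derive t 1 (F \o (fun x => x + d n)%R) (h (t + d n) * 1)%R.
      exact: is_derive1_comp.
    rewrite mulr1 in Fsh.
    by apply: is_deriveZ.
  rewrite (@continuous_FTC2 _ _ Phi)//.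
  - by rewrite /Phi !(mulrC (d n)^-1%R) EFinB.
  - apply: continuous_subspaceT => t; apply: cvgM; last exact: cvg_cst.
    apply: cvgB; last exact: ch.
    apply: (@continuous_comp _ _ _ (fun t => t + d n)%R h); last exact: ch.
    by apply: cvgD; [exact: cvg_id|exact: cvg_cst].
  - have cPhi t : (-1 < t < L + 1)%R -> {for t, continuous Phi}.
      by move=> /Phi' []/derivable1_diffP/differentiable_continuous.
    split.
    + move=> t; rewrite in_itv/= => /andP[t0 tL].
      by have [] : is_derive t 1 Phi ((d n)^-1 * (h (t + d n) - h t))%R by apply: Phi'; lra.
    + by apply: cvg_at_right_filter; apply: cPhi; lra.
    + by apply: cvg_at_left_filter; apply: cPhi; lra.
  - move=> t; rewrite in_itv/= => /andP[t0 tL].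
    rewrite derive1E mulrC.
    by have [] : is_derive t 1 Phi ((d n)^-1 * (h (t + d n) - h t))%R by apply: Phi'; lra.
have Fq x : (-1 < x < L + 2)%R -> ((F (x + d n) - F x) / d n)%R @[n --> \oo] --> h x.
  move=> /F'[dF <-].
  have dd : d @ \oo --> (0%R : R)^'.
    move=> A A0.
    have dA : \forall n \near \oo, d n != 0 -> A (d n) := d0 _ A0.
    change (\forall n \near \oo, A (d n)); apply: filterS dA => n; apply.
    by rewrite gt_eqF//; have /andP[] := d01 n.
  have Fd : (fun e => e^-1 *: (F (e *: 1 + x) - F x)) @ 0^' --> 'D_1 F x := dF.
  apply: cvg_trans (cvg_comp _ _ dd Fd); apply: near_eq_cvg; apply: nearW => n /=.
  by rewrite [d n *: 1]mulr1 [d n + x]addrC [RHS]mulrC.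
under eq_fun do rewrite qE.
apply: cvg_EFin; first by apply: nearW.
apply: cvgB; apply: Fq; lra.
Qed.

(** A Lebesgue number argument: K plays the part both of the Lipschitz constant and
    of the inverse of the distance up to which it is valid. *)
Lemma locally_lipschitz_segment h L :
  (forall t, exists r K : R, (0 < r)%R /\
    forall y z, ball t r y -> ball t r z -> (`|h y - h z| <= K * `|y - z|)%R) ->
  exists K : R, (1 <= K)%R /\ forall t t' : R, (0 <= t <= L)%R ->
    (t <= t' <= t + K^-1)%R -> (`|h t' - h t| <= K * (t' - t))%R.
Proof.
move=> hL.
pose P (K t : R) := (1 <= K)%R /\ forall t' : R, (t <= t' <= t + K^-1)%R ->
  (`|h t' - h t| <= K * (t' - t))%R.
have /compact_near_coveringP := @segment_compact R 0%R L.
move=> /(_ R (pinfty_nbhs R) P _) [].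
  move=> t _; have [r [K [r0 hK]]] := hL t.
  exists (ball t (r / 2)%R, `]Num.max 1 (Num.max K (2 / r)), +oo[%classic)%R.
    split => /=.
      by apply: nbhsx_ballx; rewrite divr_gt0.
    exists (Num.max 1 (Num.max K (2 / r)))%R; split; first exact: num_real.
    by move=> z /= Mz; rewrite /= ?in_itv/= ?andbT.
  move=> [t1 M] /= [tt1 M']. move: M'; rewrite in_itv/= andbT !gt_max => /and3P[M1 MK Mr].
  split; first exact: ltW.
  move=> t' /andP[t1t' t't1].
  have rM : (M^-1 < r / 2)%R.
    rewrite -[ltRHS]invrK invf_div ltf_pV2 ?posrE//; first lra.
    by rewrite divr_gt0.
  apply: (le_trans (hK _ _ _ _)).
  - rewrite -ball_normE /= in tt1 *; move: tt1; rewrite !ltr_norml; lra.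
  - rewrite -ball_normE /= in tt1 *; move: tt1; rewrite !ltr_norml; lra.
  - rewrite ger0_norm ?subr_ge0//; rewrite ler_wpM2r ?subr_ge0//; exact: ltW.
move=> x [_ H].
exists (Num.max 1 (x + 1)); split; first by rewrite le_max lexx.
move=> t t' tL; have [] := H (Num.max 1 (x + 1)) _ t _ => //.
- by rewrite lt_max ltrDl ltr01 orbT.
- by move=> _; apply.
Qed.

(** The increment of h is the limit of the integrals of its difference quotients
    q n.  These are bounded by K, and the assumption on G says that their upper
    limit is at most G; so the excess of |q n| over min(G, K) is bounded by K and
    tends to 0 pointwise, and its integral tends to 0 by dominated convergence. *)
Lemma segment_increment_le_integral h G L :
  (0 < L)%R ->
  (forall t, exists r K : R, (0 < r)%R /\
    forall y z, ball t r y -> ball t r z -> (`|h y - h z| <= K * `|y - z|)%R) ->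
  measurable_fun `[0, L] G -> (forall t, 0 <= G t)%E ->
  (forall t a, 0 <= t <= L -> (G t < a%:E)%E -> exists2 r, 0 < r &
     forall t', t < t' < t + r -> `|h t' - h t| <= a * (t' - t)) ->
  (`|h L - h 0|%:E <= \int[leb]_(t in `[0%R, L]) G t)%E.
Proof.
move=> L0 hL mG G0 hG.
have [K [K1 hK]] := locally_lipschitz_segment L hL.
have K0 : 0 < K by apply: lt_le_trans K1.
have ch : continuous h.
  move=> t; have [r [M [r0 hM]]] := hL t.
  apply/cvgrPdist_lt => e e0.
  apply/nbhs_ballP; exists (Num.min r (e / (`|M| + 1)))%R => /=.
    by rewrite lt_min r0 divr_gt0.
  move=> y ty.
  apply: (le_lt_trans (hM _ _ _ _)); first exact: ballxx.
    by apply: le_ball ty; rewrite ge_min lexx.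
  move: ty; rewrite -?ball_normE/= lt_min => /andP[_].
  rewrite ltr_pdivlMr ?ltr_wpDl// => tye.
  apply: (@le_lt_trans _ _ (`|M| * `|t - y|)%R).
    by rewrite ler_wpM2r ?ler_norm.
  have := normr_ge0 (t - y); nra.
pose d (n : nat) : R := (K + n%:R)^-1.
have dK n : 0 < d n <= K^-1.
  have n0 : 0 <= n%:R :> R by [].
  by rewrite invr_gt0 ltr_wpDr//= lef_pV2 ?posrE ?ltr_wpDr// lerDl.
have d01 n : 0 < d n <= 1.
  have /andP[-> /= dn] := dK n; apply: (le_trans dn).
  by rewrite invf_le1.
have d0 : d @ \oo --> 0.
  apply: (@squeeze_cvgr _ _ _ _ (cst 0) (@harmonic R)).
  - apply: nearW => n; have /andP[/ltW -> _] := d01 n; rewrite /harmonic/=.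
    rewrite lef_pV2 ?posrE//; last by rewrite ltr_wpDr.
    by rewrite -natr1 addrC lerD2r.
  - exact: cvg_cst.
  - exact: cvg_harmonic.
have cvq := integral_difference_quotient_cvg ch L0 d01 d0.
pose q n t := (h (t + d n) - h t) / d n.
pose g t := fine (mine (G t) K%:E).
have gG t : (g t)%:E = mine (G t) K%:E.
  rewrite fineK// ge0_fin_numE; first by rewrite gt_min ltry orbT.
  by rewrite le_min G0 lee_fin ltW.
have g0 t : 0 <= g t.
  by rewrite -lee_fin gG le_min G0 lee_fin ltW.
have mg : measurable_fun `[0, L] g.
  apply/measurable_EFinP; rewrite (_ : EFin \o g = fun t => mine (G t) K%:E).
    by apply: measurable_mine => //; exact: measurable_cst.
  by apply/funext => t /=; exact: gG.
pose p n t := Num.max (`|q n t| - g t) 0.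
have mq n : measurable_fun [set: R] (q n).
  apply: continuous_measurable_fun => t; apply: cvgM; last exact: cvg_cst.
  apply: cvgB; last exact: ch.
  apply: (@continuous_comp _ _ _ (fun t => t + d n)%R h); last exact: ch.
  by apply: cvgD; [exact: cvg_id|exact: cvg_cst].
have mp n : measurable_fun `[0, L] (p n).
  apply: measurable_maxr; last exact: measurable_cst.
  apply: measurable_funB => //; apply: measurableT_comp => //.
  exact: (measurable_funTS (mq n)).
have qK n t : 0 <= t <= L -> `|q n t| <= K.
  move=> tL; have /andP[dn0 dnK] := dK n.
  rewrite /q normrM normfV (gtr0_norm dn0) ler_pdivrMr//.
  have := hK t (t + d n) tL; rewrite (addrC t) addrK; apply; lra.
have pK n t : 0 <= t <= L -> `|p n t| <= K.
  move=> tL; rewrite ger0_norm ?le_max ?lexx ?orbT// ge_max (ltW K0) andbT.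
  have := g0 t; have := qK n t tL; lra.
have p0 t : 0 <= t <= L -> p ^~ t @ \oo --> 0.
  move=> tL; apply/cvgrPdist_le => e e0.
  have [KG|GK] := leP K%:E (G t).
    have gK : g t = K by rewrite /g min_r.
    apply: nearW => n; rewrite sub0r normrN /p gK.
    by rewrite max_r ?normr0 ?(ltW e0)// subr_le0; exact: qK.
  have Gg : G t = (g t)%:E by rewrite gG min_l// ltW.
  have [|r r0 hr] := hG t (g t + e) tL; first by rewrite Gg lte_fin ltrDl.
  have dr : \forall n \near \oo, d n < r by apply: (cvgr_lt 0 d0).
  apply: filterS dr => n dnr; rewrite sub0r normrN ger0_norm; last first.
    by rewrite le_max lexx orbT.
  rewrite /p ge_max (ltW e0) andbT; have /andP[dn0 _] := dK n.
  have : `|q n t| <= g t + e; last lra.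
  rewrite /q normrM normfV (gtr0_norm dn0) ler_pdivrMr//.
  have := hr (t + d n); rewrite (addrC t) addrK; apply; lra.
have [_ _ cvp] : [/\ leb.-integrable `[0, L] (fun t : R => 0%:E : \bar R),
  [sequence (\int[leb]_(t in `[0%R, L]) `|(p n t)%:E - 0%:E|)%E]_n @ \oo --> 0%E
  & [sequence (\int[leb]_(t in `[0%R, L]) (p n t)%:E)%E]_n @ \oo
      --> (\int[leb]_(t in `[0%R, L]) 0%:E)%E].
  apply: (@dominated_convergence _ _ _ leb _ _ (fun n t => (p n t)%:E) _ (cst K%:E)).
  - by [].
  - by move=> n; apply/measurable_EFinP; exact: mp.
  - exact: measurable_cst.
  - apply: aeW => t /=; rewrite in_itv/= => tL.
    by apply: cvg_EFin; [exact: nearW|exact: p0].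
  - apply: (@continuous_compact_integrable _ (cst K)); first exact: segment_compact.
    by apply: continuous_subspaceT => y; exact: cvg_cst.
  - by apply: aeW => t n /=; rewrite in_itv/= => tL; rewrite lee_fin pK.
have qle n : (`|\int[leb]_(t in `[0%R, L]) (q n t)%:E| <=
    \int[leb]_(t in `[0%R, L]) G t + \int[leb]_(t in `[0%R, L]) (p n t)%:E)%E.
  apply: le_trans; first apply: le_abse_integral => //.
    by apply/measurable_EFinP; exact: (measurable_funTS (mq n)).
  have mpE : measurable_fun `[0, L] (fun t => (p n t)%:E).
    by apply/measurable_EFinP; exact: mp.
  have p_ge0 t : 0 <= p n t by rewrite le_max lexx orbT.
  rewrite -ge0_integralD//; last by move=> t _; rewrite lee_fin.
  apply: ge0_le_integral => //.
  - by apply/measurable_EFinP; apply: measurableT_comp => //; exact: (measurable_funTS (mq n)).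
  - by apply: emeasurable_funD.
  - move=> t tL; apply: (@le_trans _ _ ((g t)%:E + (p n t)%:E)%E).
      rewrite /= -EFinD lee_fin /p; have := le_max (`|q n t| - g t) (`|q n t| - g t) 0.
      rewrite lexx/=; lra.
    by rewrite leeD2r// gG ge_min lexx.
set I := (X in (_ <= X)%E).
have [If|Iy] := boolP (I \is a fin_num); last first.
  have I0 : (0 <= I)%E by exact: integral_ge0.
  by move: Iy; rewrite ge0_fin_numE// -leNgt leye_eq => /eqP ->; rewrite leey.
have c1 := cvg_abse cvq.
rewrite integral0 in cvp.
have c2 := cvgeD (fin_num_adde_defr _ If) (cvg_cst _) cvp.
have := lee_lim (cvgP _ (c1 _)) (cvgP _ (c2 _ _)) (nearW _ qle).
rewrite (cvg_lim _ (c1 _))// (cvg_lim _ (c2 _ _))// adde0; exact.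
Qed.

End difference_quotients.

(** * The slope is an upper gradient *)

Section upper_gradient_of_slope.
Context {R : realType} {X : completeMetricType R}.
Implicit Types (u : X -> R) (c : R -> X).

Lemma arclength_parametrized_lipschitz c (L a b : R) : arclength_parametrized c L ->
  (0 <= a)%R -> (a <= b)%R -> (b <= L)%R -> (mdist (c a) (c b) <= b - a)%R.
Proof.
move=> cL a0; rewrite le_eqVlt => /predU1P[->|ab] bL.
  by rewrite mdistxx subrr.
rewrite -lee_fin -(cL a b)//; last exact: ltW.
apply: ereal_sup_ubound; exists [:: b]; first exact: itv_partition1.
by rewrite /curve_variation /= big_nat1.
Qed.

Lemma continuous_curve_measurable c : continuous c ->
  measurable_fun [set: measurableTypeR R] (c : measurableTypeR R -> borel X).
Proof.
move=> cc; apply: (@measurability _ _ _ (borel X) _ _ (@open X)) => //.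
move=> _ [U oU <-]; rewrite setTI; apply: open_measurable.
by apply: open_comp => // x _; exact: cc.
Qed.

(** Along a curve parametrized by arclength the distance covered is at most the
    elapsed time, so the increments of u over a short time are controlled by the
    slope of u at the starting point. *)
Lemma lip_upper_gradient u : locally_lipschitz u -> upper_gradient u (lip u).
Proof.
move=> uL; have cu := locally_lipschitz_continuous uL.
have mlip := measurable_lip cu.
split=> //; first exact: lip_ge0.
move=> c L; rewrite le_eqVlt => /predU1P[<- _|L0 cL].
  by rewrite subrr normr0; apply: integral_ge0 => t _; exact: lip_ge0.
(* The curve is constrained only on [0, L]; composing with the projection onto
   this segment makes it Lipschitz on the whole line. *)
pose k t : R := Num.max 0%R (Num.min t L).
have k0L t : (0 <= k t <= L)%R.
  by rewrite le_max lexx/= ge_max (ltW L0)/= ge_min lexx orbT.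
have kE t : (0 <= t <= L)%R -> k t = t.
  by move=> /andP[t0 tL]; rewrite /k min_l// max_r.
have k_lip t t' : (t <= t')%R -> (0 <= k t' - k t <= t' - t)%R.
  move=> tt'; rewrite /k; have := L0.
  rewrite !maxEle !minEle; do ![case: ifPn|rewrite -ltNge]; lra.
pose c' := c \o k.
have c'_lip t t' : (mdist (c' t) (c' t') <= `|t - t'|)%R.
  wlog tt' : t t' / (t <= t')%R.
    move=> H; have [|t't] := leP t t'; first exact: H.
    by rewrite metric_sym distrC; apply: H; exact: ltW.
  have := k_lip _ _ tt'.
  have /andP[k0 kL] := k0L t; have /andP[k0' kL'] := k0L t' => /andP[kk ktt].
  rewrite distrC ger0_norm ?subr_ge0//; apply: le_trans ktt.
  by apply: (arclength_parametrized_lipschitz cL) => //; rewrite -subr_ge0.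
have cc' : continuous c'.
  move=> t; apply/cvg_ballP => e e0.
  apply/nbhs_ballP; exists e => //= t' tt'.
  rewrite ballEmdist/=; apply: le_lt_trans (c'_lip _ _) _.
  by move: tt'; rewrite -?ball_normE.
have -> : \int[lebesgue_measure]_(t in `[0%R, L]) lip u (c t) =
    \int[lebesgue_measure]_(t in `[0%R, L]) lip u (c' t).
  apply: eq_integral => t; rewrite inE/= in_itv/= => tL.
  by rewrite /c'/= kE.
have -> : c L = c' L by rewrite /c'/= kE// lexx ltW.
have -> : c 0%R = c' 0%R by rewrite /c'/= kE// lexx ltW.
apply: (@segment_increment_le_integral _ (u \o c') (lip u \o c')) => //.
- move=> t; have [r [K [r0 uK]]] := uL (c' t).
  exists r, `|K|%R; split => // y z.
  rewrite -!ball_normE/= => ty tz.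
  apply: (le_trans (uK _ _ _ _)).
  + by rewrite ballEmdist/=; exact: le_lt_trans (c'_lip _ _) _.
  + by rewrite ballEmdist/=; exact: le_lt_trans (c'_lip _ _) _.
  + apply: (@le_trans _ _ (`|K| * mdist (c' y) (c' z))%R).
      by rewrite ler_wpM2r ?mdist_ge0 ?ler_norm.
    by rewrite ler_wpM2l.
- apply: measurable_funTS.
  exact: (measurableT_comp mlip (continuous_curve_measurable cc')).
- by move=> t; exact: lip_ge0.
- move=> t a tL lipa.
  have a0 : (0 < a)%R by rewrite -lte_fin; exact: (le_lt_trans (lip_ge0 _ _) lipa).
  have [b [r [/andP[b0 ba] r0 ub]]] := (lip_ltP _ _ a0).1 lipa.
  exists r => // t' /andP[tt' t'tr].
  have ct : (mdist (c' t) (c' t') <= t' - t)%R.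
    apply: le_trans (c'_lip _ _) _; rewrite distrC ger0_norm ?subr_ge0//; exact: ltW.
  apply: (le_trans (ub _ _)); first by rewrite ballEmdist/=; apply: le_lt_trans ct _; lra.
  by apply: ler_pM => //; [exact: mdist_ge0|exact: ltW].
Qed.

End upper_gradient_of_slope.

(** * Compactness of bounded sets *)

Section bounded_sets.
Context {R : realType} {X : completeMetricType R}.
Variable mu : {measure set (borel X) -> \bar R}.
Hypothesis Xmms : metric_measure_space mu.

Lemma finite_measure_ball (x : X) (r : R) : mu (ball x r) < +oo.
Proof. by apply: Xmms.2; [exact: ball_borel|exists x, r]. Qed.

Lemma fin_num_measure_ball (x : X) (r : R) : mu (ball x r) \is a fin_num.
Proof. by rewrite ge0_fin_numE ?finite_measure_ball. Qed.

(** Disjoint balls of a fixed small radius centred in a bounded set have measure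
    bounded below and lie in a set of finite measure, so there are finitely many
    of them; a Vitali family with constant radius is such a family. *)
Lemma ahlfors_totally_bounded (s : R) (x0 : X) (N e : R) :
  uniformly_lower_Ahlfors_regular mu s -> (0 < e)%R ->
  exists2 S : set X, finite_set S & ball x0 N `<=` \bigcup_(y in S) ball y e.
Proof.
move=> [rho [C [rho0 C0 ahl]]] e0.
pose r := Num.min rho (Num.min 1%R (e / 3)%R).
have r0 : (0 < r)%R by rewrite !lt_min rho0 ltr01 divr_gt0.
have rrho : (r <= rho)%R by rewrite ge_min lexx.
have r1 : (r <= 1)%R by rewrite !ge_min lexx orbT.
have re : (3 * r <= e)%R.
  have : (r <= e / 3)%R by rewrite !ge_min lexx !orbT.
  lra.
have [D [DB tD BD]] := @vitali_covering_radii R X (ball x0 N) (fun=> r) 1%R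
  (fun _ _ => introT andP (conj r0 r1)).
exists D; last first.
  by apply: subset_trans BD _; apply: subset_bigcup => y _; exact: le_ball.
apply: contrapT => Dinf.
pose M := fine (mu (ball x0 (N + 1))).
pose a := (C * r `^ s)%R.
have a0 : (0 < a)%R by rewrite mulr_gt0// powR_gt0.
have [B BD' nB] := infinite_set_fset (Num.trunc (M / a)).+1 Dinf.
have : (\sum_(i <- finmap.enum_fset B) a%:E <= M%:E).
  rewrite /M fineK ?fin_num_measure_ball//.
  apply: (@le_trans _ _ (\sum_(i <- finmap.enum_fset B) mu (ball i r))).
    by apply: lee_sum => i _; exact: ahl.
  rewrite -measure_fbigsetU; last 2 first.
  - by move=> i _; exact: ball_borel.
  - by move=> i j Bi Bj; apply: tD; exact: BD'.
  rewrite -bigcup_fset le_measure ?inE//.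
  - by apply: fin_bigcup_measurable => // i _; exact: ball_borel.
  - exact: ball_borel.
  - move=> z [i Bi iz]; have := BD' _ Bi => /DB xi.
    by apply: (ball_triangle xi); exact: le_ball iz.
rewrite sumEFin big_const_seq count_predT iter_addr_0 lee_fin leNgt => /negP; apply.
rewrite -mulr_natl mulrC -ltr_pdivrMl// mulrC.
by apply: lt_le_trans (truncnS_gt _) _; rewrite ler_nat.
Qed.

(** An ultrafilter on a totally bounded set contains balls of every radius, hence is
    Cauchy and converges. *)
Lemma compact_closure_ball (s : R) (x0 : X) (N : R) :
  uniformly_lower_Ahlfors_regular mu s -> compact (closure (ball x0 N)).
Proof.
move=> ahl; rewrite compact_ultra => F FU FK.
have FX : cauchy_ex F.
  move=> e e0.
  have [S finS KS] := ahlfors_totally_bounded x0 (N + 1) ahl e0.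
  apply: contrapT => nF.
  have {}nF y : F (~` ball y e).
    by have [Fy|//] := in_ultra_setVsetC (ball y e) FU; exfalso; apply: nF; exists y.
  have FS : F (\bigcap_(y in S) ~` ball y e).
    have [S' ->] := finite_fsetP.1 finS.
    by apply: filter_bigI => y _; exact: nF.
  have [y [Ky Sy]] := filter_ex (filterI FK FS).
  have [z [x0z yz]] := Ky (ball y 1%R) (nbhsx_ballx _ _ ltr01).
  have [|t St ty] := KS y.
    by apply: ball_triangle x0z _; exact: ball_sym.
  exact: (Sy t St).
have /cauchy_cvg Fcvg : cauchy F by exact: cauchy_exP.
exists (lim F); split => //.
exact: (@closed_cvg _ _ F _ id _ (@closed_closure _ (ball x0 N)) FK _ Fcvg).
Qed.

Lemma integral_setU_le (A B : set X) (g : X -> \bar R) :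
  measurable (A : set (borel X)) -> measurable (B : set (borel X)) ->
  measurable_fun [set: borel X] (g : borel X -> \bar R) -> (forall x, 0 <= g x) ->
  \int[mu]_(x in (A `|` B : set (borel X))) g x <=
  \int[mu]_(x in (A : set (borel X))) g x + \int[mu]_(x in (B : set (borel X))) g x.
Proof.
move=> mA mB mg g0.
have mBA : measurable (B `\` A : set (borel X)) by exact: measurableD.
have -> : A `|` B = A `|` (B `\` A).
  apply/seteqP; split=> x; have [Ax|nAx] := pselect (A x).
  - by left.
  - by case=> // Bx; right.
  - by left.
  - by case=> // -[Bx _]; right.
rewrite ge0_integral_setU//.
- rewrite leeD2l//; apply: ge0_subset_integral => //; exact: measurable_funTS.
- exact: measurable_funTS.
- by apply/disj_setPS => x [Ax [_ /(_ Ax)]].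
Qed.

(** Finitely many of the neighbourhoods on which convergence is known cover a
    ball, its closure being compact. *)
Lemma cvg_L1loc_ball (s : R) (u_ : nat -> X -> R) (f : X -> R) :
  uniformly_lower_Ahlfors_regular mu s ->
  measurable_fun [set: borel X] (f : borel X -> R) ->
  (forall i, measurable_fun [set: borel X] (u_ i : borel X -> R)) ->
  cvg_L1loc mu u_ f -> forall (x0 : X) (N : R),
  \int[mu]_(y in (ball x0 N : set (borel X))) `|u_ i y - f y|%:E
    @[i --> \oo] --> 0.
Proof.
move=> ahl mf mu_ cvu x0 N.
pose g i y := `|u_ i y - f y|%:E.
have g0 i y : 0 <= g i y by rewrite lee_fin.
have mg i : measurable_fun [set: borel X] (g i : borel X -> \bar R).
  by apply/measurable_EFinP; apply: measurableT_comp => //; exact: measurable_funB.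
have /choice[r rP] : forall x, exists r : R, (0 < r)%R /\
    \int[mu]_(y in (ball x r : set (borel X))) g i y @[i --> \oo] --> 0.
  by move=> x; have [r r0 cr] := cvu x; exists r.
have cptK := @compact_closure_ball s x0 N ahl.
rewrite compact_cover in cptK.
have [S _ KS] :
  finite_subset_cover [set: X] (fun x => ball x (r x)) (closure (ball x0 N)).
  apply: cptK => [x _|x _]; first exact: open_metric_ball.
  by exists x => //; apply: ballxx; exact: (rP x).1.
have mU (t : seq X) : measurable (\big[setU/set0]_(x <- t) ball x (r x) : set (borel X)).
  by apply: bigsetU_measurable => x _; exact: ball_borel.
have cvU (t : seq X) : \int[mu]_(y in (\big[setU/set0]_(x <- t) ball x (r x)
    : set (borel X))) g i y @[i --> \oo] --> 0.
  elim: t => [|x t IH].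
    under eq_fun do rewrite big_nil integral_set0.
    exact: cvg_cst.
  apply: (@squeeze_cvge _ _ _ _ (cst 0) _ (fun i =>
    \int[mu]_(y in (ball x (r x) : set (borel X))) g i y +
    \int[mu]_(y in (\big[setU/set0]_(x <- t) ball x (r x) : set (borel X))) g i y)).
  - apply: nearW => i; rewrite integral_ge0//= big_cons.
    apply: integral_setU_le => //; exact: ball_borel.
  - exact: cvg_cst.
  - by rewrite -[X in _ --> X]adde0; apply: cvgeD => //; exact: (rP x).2.
apply: (@squeeze_cvge _ _ _ _ (cst 0) _ (fun i =>
    \int[mu]_(y in (\big[setU/set0]_(x <- finmap.enum_fset S) ball x (r x)
      : set (borel X))) g i y)).
- apply: nearW => i; rewrite integral_ge0//=.
  apply: ge0_subset_integral => //; [exact: ball_borel|exact: (measurable_funTS (mg i))|].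
  by rewrite -bigcup_fset; move=> z x0z; apply: KS => B /nbhs_singleton Bz; exists z.
- exact: cvg_cst.
- exact: cvU.
Qed.

End bounded_sets.

(** * Estimates on one ball *)

Section local_estimates.
Context {R : realType} {X : completeMetricType R}.
Variable mu : {measure set (borel X) -> \bar R}.
Hypothesis Xmms : metric_measure_space mu.

Lemma locally_lipschitz_L1loc (u : X -> R) : locally_lipschitz u -> L1loc mu u.
Proof.
move=> uL; have mu_u := continuous_borel (locally_lipschitz_continuous uL).
split=> // x; have [r [L [r0 uLx]]] := uL x.
exists r => //; apply: measurable_bounded_integrable.
- exact: ball_borel.
- exact: finite_measure_ball.
- exact: measurable_funTS.
exists (`|u x| + `|L| * r)%R; split; first exact: num_real.
move=> M LM y /= xy; apply: le_trans (ltW LM).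
have uxy : (`|u x - u y| <= `|L| * r)%R.
  apply: (le_trans (uLx _ _ (ballxx _ r0) xy)).
  apply: (@le_trans _ _ (`|L| * mdist x y)%R).
    by rewrite ler_wpM2r ?mdist_ge0 ?ler_norm.
  by rewrite ler_wpM2l// ltW//; move: xy; rewrite ballEmdist.
have : (`|u y| <= `|u x| + `|u x - u y|)%R.
  by rewrite -{1}(subKr (u x) (u y)); exact: ler_normB.
lra.
Qed.

Lemma measurable_dist_indic (u : X -> R) (E : set X) : locally_lipschitz u ->
  measurable (E : set (borel X)) ->
  measurable_fun [set: borel X] (fun y : borel X => `|u y - \1_E y|%:E).
Proof.
move=> uL mE; apply/measurable_EFinP; apply: measurableT_comp => //.
apply: measurable_funB; last exact: measurable_indic.
exact: (continuous_borel (locally_lipschitz_continuous uL)).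
Qed.

(** Chebyshev's inequality. *)
Lemma measure_le_integral (S W : set X) (w : X -> \bar R) (a : R) :
  measurable (S : set (borel X)) -> measurable (W : set (borel X)) ->
  S `<=` W -> measurable_fun [set: borel X] (w : borel X -> \bar R) ->
  (forall x, 0 <= w x) -> (0 <= a)%R -> (forall x, S x -> a%:E <= w x) ->
  a%:E * mu S <= \int[mu]_(x in (W : set (borel X))) w x.
Proof.
move=> mS mW SW mw w0 a0 aw.
rewrite -integral_cst//.
apply: (@le_trans _ _ (\int[mu]_(x in (S : set (borel X))) w x)).
  apply: ge0_le_integral => //; exact: measurable_funTS.
by apply: ge0_subset_integral => //; exact: measurable_funTS.
Qed.

(** Let a and b be the measures of E and of its complement in the ball.  The
    integral of |1_E - m| over the ball is |1 - m| a + |m| b, which is at least a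
    since a <= b and |1 - m| + |m| >= 1. *)
Lemma relative_isoperimetric (u : X -> R) (E : set X) (x : X) (r m : R) :
  locally_lipschitz u -> measurable (E : set (borel X)) ->
  2%:E * mu (E `&` ball x r) <= mu (ball x r) ->
  mu (E `&` ball x r) <=
    \int[mu]_(y in (ball x r : set (borel X))) `|u y - \1_E y|%:E +
    \int[mu]_(y in (ball x r : set (borel X))) `|u y - m|%:E.
Proof.
move=> uL mE half.
have mB := ball_borel x r.
have mEB : measurable (E `&` ball x r : set (borel X)) by exact: measurableI.
have mBE : measurable (ball x r `\` E : set (borel X)) by exact: measurableD.
have mw := measurable_dist_indic uL mE.
have mum : measurable_fun [set: borel X] (fun y : borel X => `|u y - m|%:E).
  apply/measurable_EFinP; apply: measurableT_comp => //.
  apply: measurable_funB => //.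
  exact: (continuous_borel (locally_lipschitz_continuous uL)).
have m1m : measurable_fun [set: borel X] (fun y : borel X => `|\1_E y - m|%:E).
  apply/measurable_EFinP; apply: measurableT_comp => //.
  by apply: measurable_funB => //; exact: measurable_indic.
rewrite -ge0_integralD//; [|exact: measurable_funTS|exact: measurable_funTS].
apply: (@le_trans _ _
  (\int[mu]_(y in (ball x r : set (borel X))) `|\1_E y - m|%:E)); last first.
  apply: ge0_le_integral => //.
  - exact: measurable_funTS.
  - by apply: emeasurable_funD; exact: measurable_funTS.
  - move=> y _; rewrite -EFinD lee_fin.
    have -> : (\1_E y - m = (u y - m) - (u y - \1_E y))%R by ring.
    by rewrite [leRHS]addrC; exact: ler_normB.
have BE : ball x r = (E `&` ball x r) `|` (ball x r `\` E).
  apply/seteqP; split=> y.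
    by move=> xy; have [Ey|nEy] := pselect (E y); [left|right].
  by case=> [[]|[]].
have [a aE] : exists a : R, mu (E `&` ball x r) = a%:E.
  exists (fine (mu (E `&` ball x r))); rewrite fineK// ge0_fin_numE//.
  by apply: le_lt_trans (finite_measure_ball Xmms x r); apply: le_measure; rewrite ?inE//.
have [b bE] : exists b : R, mu (ball x r `\` E) = b%:E.
  exists (fine (mu (ball x r `\` E))); rewrite fineK// ge0_fin_numE//.
  by apply: le_lt_trans (finite_measure_ball Xmms x r); apply: le_measure; rewrite ?inE//.
have ab : mu (ball x r) = (a + b)%:E.
  rewrite EFinD -aE -bE {1}BE; apply: measureU => //.
  by apply/seteqP; split=> y //= [[Ey _] [_ /(_ Ey)]].
rewrite ab aE lee_fin in half.
rewrite [in leRHS]BE ge0_integral_setU//; last 2 first.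
- exact: measurable_funTS.
- by apply/disj_setPS => y [[Ey _] [_ /(_ Ey)]].
apply: (@le_trans _ _ ((`|1 - m| * a)%:E + (`|m| * b)%:E)); last first.
  apply: leeD.
    rewrite EFinM -aE; apply: measure_le_integral => // y [Ey _].
    by rewrite indicE mem_set.
  rewrite EFinM -bE; apply: measure_le_integral => // y [_ nEy].
  by rewrite indicE memNset// sub0r normrN.
rewrite aE -EFinD lee_fin.
have a0 : (0 <= a)%R by rewrite -lee_fin -aE.
have := normr_ge0 m; have := normr_ge0 (1 - m)%R.
have : (1 <= `|1 - m| + `|m|)%R.
  have := ler_normD (1 - m)%R m; rewrite subrK normr1; exact.
nra.
Qed.

Lemma doubling_iter (D rho : R) (k : nat) (x : X) (r : R) :
  (forall (x : X) (r : R), (0 < r)%R -> (r <= rho)%R ->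
      mu (ball x (2 * r)%R) <= D%:E * mu (ball x r)) ->
  (0 < D)%R -> (0 < r)%R -> (2 ^+ k * r <= rho)%R ->
  mu (ball x (2 ^+ k * r)%R) <= (D ^+ k)%:E * mu (ball x r).
Proof.
move=> dbl D0 r0; elim: k => [|k IH] kr.
  by rewrite !expr0 mul1r mul1e.
have kr' : (0 < 2 ^+ k * r)%R by rewrite mulr_gt0// exprn_gt0.
rewrite exprS -mulrA in kr *.
have kr2 : (2 ^+ k * r <= rho)%R by lra.
apply: (le_trans (dbl _ _ kr' kr2)).
rewrite exprS EFinM -muleA lee_pmul2l//.
exact: IH.
Qed.

End local_estimates.

(** * The estimate for one approximating function *)

Section one_approximation.
Context {R : realType} {X : completeMetricType R}.
Variable mu : {measure set (borel X) -> \bar R}.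
Hypothesis Xmms : metric_measure_space mu.
Variables (s rho C0 D lambda CP : R) (m : nat).
Hypotheses (s0 : (0 < s)%R) (rho0 : (0 < rho)%R) (C00 : (0 < C0)%R)
  (D1 : (1 <= D)%R) (lambda1 : (1 <= lambda)%R) (CP0 : (0 < CP)%R)
  (m_lambda : (3 * lambda <= 2 ^+ m)%R).
Hypothesis ahlfors : forall (x : X) (r : R), (0 < r)%R -> (r <= rho)%R ->
  (C0 * r `^ s)%:E <= mu (ball x r).
Hypothesis doubling : forall (x : X) (r : R), (0 < r)%R ->
  (r <= 2 ^+ m * rho)%R -> mu (ball x (2 * r)%R) <= D%:E * mu (ball x r).
Hypothesis poincare : forall (u : X -> R), locally_lipschitz u ->
  forall (x : X) (r : R), (0 < r)%R -> (r <= rho)%R -> exists a : R,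
    \int[mu]_(y in (ball x r : set (borel X))) `|u y - a|%:E <=
      (CP * r)%:E *
      \int[mu]_(y in (ball x (lambda * r)%R : set (borel X))) lip u y.

(** The density threshold: two doublings lead from 4B to B, so that density at most
    c in 4B gives mu(E \cap 4B) <= 1/2 mu(B). *)
Let c := ((2 * D ^+ 2)^-1)%R.
(** A bound for the ratio of mu(3 lambda B) to mu(E \cap B) at the scale chosen in
    [isoperimetric_scale]: m doublings lead from B to a ball containing
    3 lambda B, and D / c compares B with its part in E. *)
Let K := (D ^+ m * (D / c))%R.
Let scale (k : nat) := (rho / 2 ^+ k)%R.

Let D0 : (0 < D)%R. Proof. exact: lt_le_trans D1. Qed.
Let c0 : (0 < c)%R. Proof. by rewrite invr_gt0 mulr_gt0// exprn_gt0. Qed.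
Let cD : (c * D ^+ 2 = 1 / 2)%R.
Proof. by rewrite /c; field; rewrite gt_eqF. Qed.
Let c12 : (2 * c <= 1)%R.
Proof. have : (1 <= D ^+ 2)%R by rewrite exprn_ege1. have := c0; have := cD; nra. Qed.
Let K0 : (0 < K)%R.
Proof. by rewrite /K mulr_gt0 ?exprn_gt0 // divr_gt0 // c0. Qed.
Let scale_gt0 k : (0 < scale k)%R.
Proof. by rewrite divr_gt0// exprn_gt0. Qed.
Let scale_le k : (scale k <= rho)%R.
Proof. by rewrite ler_pdivrMr ?exprn_gt0// ler_peMr ?(ltW rho0)// exprn_ege1// ler1n. Qed.
Let scaleS k : (2 * scale k.+1 = scale k)%R.
Proof. by rewrite /scale exprS; field; rewrite gt_eqF// exprn_gt0. Qed.
Let rho_m : (rho <= 2 ^+ m * rho)%R.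
Proof. by rewrite ler_peMl ?(ltW rho0)// exprn_ege1// ler1n. Qed.

Variables (E : set X) (mE : R).
Hypotheses (measE : measurable (E : set (borel X))) (muE : mu E = mE%:E)
  (mE_small : (mE < c * (C0 * rho `^ s))%R).

Let thick (x : X) (k : nat) :=
  c%:E * mu (ball x (scale k)) <= mu (E `&` ball x (scale k)).

(** A bound on the radius of a ball in which E has density at least c / D: lower
    regularity bounds the measure of such a ball below by C0 r^s, and it is at
    most (D / c) mu(E). *)
Let M := ((D / (c * C0) * mE) `^ s^-1)%R.

Lemma not_thick0 x : ~~ thick x 0.
Proof.
rewrite /thick -ltNge; apply: (@le_lt_trans _ _ (mu E)).
  by apply: measureIl => //; exact: ball_borel.
rewrite muE; apply: (@lt_le_trans _ _ (c * (C0 * rho `^ s))%:E).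
  by rewrite lte_fin.
rewrite EFinM lee_pmul2l//.
by have := ahlfors x (scale_gt0 0) (scale_le 0); rewrite /scale expr0 divr1.
Qed.

(** The scale chosen is the last one before the density first reaches c: there it is
    still below c, hence below 1/2, and by doubling it is at least c / D. *)
Lemma isoperimetric_scale x : (exists k, thick x k) -> exists j,
  [/\ (scale j <= M)%R, 2%:E * mu (E `&` ball x (scale j)) <= mu (ball x (scale j)) &
  mu (ball x (scale j)) <= (D / c)%:E * mu (E `&` ball x (scale j))].
Proof.
move=> xk.
case: (ex_minnP xk) => -[|j].
  by rewrite (negbTE (not_thick0 x)).
move=> dj minj; have ndj : ~~ thick x j.
  by apply/negP => /minj; rewrite ltnn.
have EB k : measurable (E `&` ball x (scale k) : set (borel X)).
  by apply: measurableI => //; exact: ball_borel.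
have bE k : mu (E `&` ball x (scale k)) <= mu E.
  by apply: measureIl => //; exact: ball_borel.
have EjS : mu (E `&` ball x (scale j.+1)) <= mu (E `&` ball x (scale j)).
  apply: le_measure; rewrite ?inE//; apply: setIS; apply: le_ball.
  by rewrite -(scaleS j); have := scale_gt0 j.+1; lra.
have Bj : mu (ball x (scale j)) <= (D / c)%:E * mu (E `&` ball x (scale j)).
  rewrite -[in leLHS]scaleS.
  apply: (@le_trans _ _ (D%:E * mu (ball x (scale j.+1)))).
    by apply: doubling => //; exact: le_trans (scale_le _) rho_m.
  rewrite EFinM -muleA lee_pmul2l//.
  apply: le_trans (_ : (c^-1)%:E * mu (E `&` ball x (scale j.+1)) <= _).
    by rewrite lee_pdivlMl.
  by rewrite lee_pmul2l// lte_fin invr_gt0.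
exists j; split => //.
- have : (C0 * scale j `^ s)%:E <= (D / c * mE)%:E.
    apply: (le_trans (ahlfors x (scale_gt0 j) (scale_le j))).
    apply: (le_trans Bj); rewrite [leRHS]EFinM -muE lee_pmul2l// lte_fin.
    by rewrite divr_gt0.
  rewrite lee_fin mulrC -ler_pdivlMr//.
  have -> : (D / c * mE / C0 = D / (c * C0) * mE)%R by rewrite invfM; ring.
  move=> sj.
  have -> : scale j = ((scale j `^ s) `^ s^-1)%R.
    by rewrite -powRrM divff ?gt_eqF// powRr1// ltW.
  apply: ge0_ler_powR; rewrite ?nnegrE ?powR_ge0//.
  + by rewrite invr_ge0 ltW.
  + by apply: le_trans sj; exact: powR_ge0.
- rewrite -ltNge in ndj.
apply: (@le_trans _ _ (2%:E * (c%:E * mu (ball x (scale j))))).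
    by rewrite lee_pmul2l// ltW.
  rewrite muleA -EFinM -[leRHS]mul1e lee_wpmul2r// lee_fin.
Qed.


(** The function phi has one term for each way in which a point can be covered:
    1/2 on U and V pays for the points where E is sparse at every scale, and the
    other two terms pay for the two sides of the relative isoperimetric inequality
    at the remaining points.  The enlarged ball V' contains all balls of radius at
    most rho centred in V. *)
Lemma localized_isoperimetric_estimate (u : X -> R) (x0 : X) (N eps J : R) :
  locally_lipschitz u ->
  \int[mu]_(y in (ball x0 (N + rho)%R : set (borel X))) `|u y - \1_E y|%:E <= eps%:E ->
  \int[mu]_(y in [set: borel X]) lip u y <= J%:E ->
  mu (E `&` ball x0 N) <= (2 * (K + 3) * eps + 2 * K * CP * M * J)%:E.
Proof.
move=> uL w_eps lipJ.
have cu := locally_lipschitz_continuous uL.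
have mlip := measurable_lip cu.
pose w y := `|u y - \1_E y|%:E.
have mw : measurable_fun [set: borel X] (w : borel X -> \bar R).
  exact: measurable_dist_indic.
have w0 y : 0 <= w y by rewrite lee_fin.
pose V := ball x0 N; pose V' := ball x0 (N + rho)%R.
pose U := [set y | (1 / 2 < u y)%R].
have VV' : V `<=` V' by apply: le_ball; rewrite lerDl ltW.
have oU : open U.
  rewrite (_ : U = u @^-1` `](1 / 2)%R, +oo[%classic).
    by apply: open_comp => [y _|]; [exact: cu|exact: interval_open].
  by apply/seteqP; split => y /=; rewrite in_itv/= andbT.
have oW : open (U `&` V) by apply: openI => //; exact: open_metric_ball.
have mU := open_borel oU; have mV : measurable (V : set (borel X)) := ball_borel x0 N.
have mV' : measurable (V' : set (borel X)) := ball_borel x0 _.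
have mW := open_borel oW.
have M0 : (0 <= M)%R by exact: powR_ge0.
pose A := E `&` (U `&` V).
have mA : measurable (A : set (borel X)) by exact: measurableI.
pose L := (K * CP * M)%R.
have L0 : (0 <= L)%R by apply: mulr_ge0 => //; apply: mulr_ge0; exact: ltW.
pose phi y := ((cst (1 / 2)%:E) \_ (U `&` V)) y + ((fun y => K%:E * w y) \_ V') y +
  L%:E * lip u y.
pose phi1 : X -> \bar R := (cst (1 / 2)%:E) \_ (U `&` V).
pose phi2 : X -> \bar R := (fun y => K%:E * w y) \_ V'.
have phi10 y : 0 <= phi1 y.
  by apply: erestrict_ge0 => z _; rewrite lee_fin.
have phi20 y : 0 <= phi2 y.
  by apply: erestrict_ge0 => z _; rewrite mule_ge0// lee_fin ltW.
have phi30 y : 0 <= L%:E * lip u y by rewrite mule_ge0 ?lip_ge0.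
have mphi1 : measurable_fun [set: borel X] (phi1 : borel X -> \bar R).
  by apply/(measurable_restrictT (cst (1 / 2)%:E)) => //; exact: measurable_cst.
have mKw : measurable_fun [set: borel X] (fun y : borel X => K%:E * w y).
  by apply: emeasurable_funM => //; exact: measurable_cst.
have mphi2 : measurable_fun [set: borel X] (phi2 : borel X -> \bar R).
  apply: (iffLR (@measurable_restrictT _ _ (borel X) _ V'
    (fun y : borel X => K%:E * w y) _)) => //; exact: measurable_funTS.
have mphi3 : measurable_fun [set: borel X] (fun y : borel X => L%:E * lip u y).
  by apply: emeasurable_funM => //; exact: measurable_cst.
have intphi (S : set X) : measurable (S : set (borel X)) ->
    \int[mu]_(y in (S : set (borel X))) phi y =
    (1 / 2)%:E * mu (S `&` (U `&` V)) +
    K%:E * \int[mu]_(y in (S `&` V' : set (borel X))) w y +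
    L%:E * \int[mu]_(y in (S : set (borel X))) lip u y.
  move=> mS.
  rewrite ge0_integralD//; first last.
  - exact: measurable_funTS.
  - by apply: emeasurable_funD; exact: measurable_funTS.
  - by move=> y _; rewrite adde_ge0.
  rewrite ge0_integralD//; first last.
  - exact: measurable_funTS.
  - exact: measurable_funTS.
  rewrite -!integral_mkcondr integral_cst; last exact: measurableI.
  rewrite ge0_integralZl_EFin//; first last.
  - exact: ltW.
  - exact: measurable_funTS.
  - exact: measurableI.
  rewrite ge0_integralZl_EFin//; first by move=> y _; exact: lip_ge0.
  exact: measurable_funTS.
have phi0 y : 0 <= phi y by rewrite !adde_ge0.
have mphi : measurable_fun [set: borel X] (phi : borel X -> \bar R).
  by apply: emeasurable_funD => //; exact: emeasurable_funD.
have pointwise x : A x -> exists r : R, (0 < r <= lambda * rho)%R /\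
    mu (A `&` ball x (3 * r)%R) <= \int[mu]_(y in (ball x r : set (borel X))) phi y.
  move=> Ax; have [xd|xnd] := pselect (exists k, thick x k).
  (* E reaches density c: the ball is enlarged by lambda so that the right-hand
     side of the Poincare inequality is an integral over the selected ball. *)
  - have [j [jM half BE]] := isoperimetric_scale xd.
    set r := scale j in jM half BE.
    have r0 : (0 < r)%R by exact: scale_gt0.
    have rrho : (r <= rho)%R by exact: scale_le.
    exists (lambda * r)%R; split.
      by rewrite mulr_gt0 ?ler_pM2l//; apply: lt_le_trans lambda1.
    have [a Pa] := poincare uL x r0 rrho.
    have iso := relative_isoperimetric Xmms a uL measE half.
    have BV' : ball x r `<=` V'.
      by move=> z xz; apply: (ball_triangle Ax.2.2); exact: le_ball xz.
    have BlB : ball x r `<=` ball x (lambda * r)%R.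
      by apply: le_ball; rewrite ler_peMl// ltW.
    have mB := ball_borel x r; have mlB := ball_borel x (lambda * r)%R.
    set I := \int[mu]_(y in (ball x (lambda * r)%R : set (borel X))) lip u y in Pa *.
    have I0 : 0 <= I by apply: integral_ge0 => y _; exact: lip_ge0.
    set Iw := \int[mu]_(y in (ball x r : set (borel X))) w y.
    have Iw0 : 0 <= Iw by exact: integral_ge0.
    have KB : mu (A `&` ball x (3 * (lambda * r))%R) <= K%:E * mu (E `&` ball x r).
      apply: (@le_trans _ _ (mu (ball x (2 ^+ m * r)%R))).
        apply: le_measure; rewrite ?inE; [|exact: ball_borel|].
          by apply: measurableI => //; exact: ball_borel.
        move=> z [_]; apply: le_ball; rewrite mulrA ler_pM2r//.
      apply: (@le_trans _ _ ((D ^+ m)%:E * mu (ball x r))).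
        apply: (doubling_iter _ doubling) => //.
        by rewrite ler_pM2l// exprn_gt0.
      by rewrite EFinM -muleA lee_pmul2l// lte_fin exprn_gt0.
    apply: (le_trans KB).
    apply: (@le_trans _ _ (K%:E * Iw + L%:E * I)).
      apply: (@le_trans _ _ (K%:E * (Iw + (CP * r)%:E * I))).
        rewrite lee_pmul2l//; apply: (le_trans iso).
        by rewrite leeD2l.
      rewrite ge0_muleDr//; last by rewrite mule_ge0// lee_fin mulr_ge0// ltW.
      rewrite leeD2l// muleA -EFinM lee_wpmul2r// lee_fin /L -mulrA.
      by rewrite ler_pM2l// ler_pM2l.
    rewrite intphi// -[leLHS]add0e -addeA; apply: leeD.
      by rewrite mule_ge0.
    rewrite leeD2r// lee_pmul2l//; apply: ge0_subset_integral => //.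
    - exact: measurableI.
    - exact: measurable_funTS.
    - by move=> z xz; split; [exact: BlB|exact: BV'].
  (* E is sparse at every scale: the ball is taken inside U and V, and its triple
     lies in the ball two scales above. *)
  - have ndx k : mu (E `&` ball x (scale k)) <= c%:E * mu (ball x (scale k)).
      by apply: ltW; rewrite ltNge; apply/negP => dk; apply: xnd; exists k.
    have [k kW] : exists k, ball x (scale k.+2) `<=` U `&` V.
      move: (oW); rewrite openE => /(_ x Ax.2)/nbhs_ballP[e /= e0 eW].
      have [n ne] := exists_natSinv_lt (divr_gt0 e0 rho0).
      exists n; apply: subset_trans eW; apply: le_ball.
      rewrite /scale mulrC -ler_pdivlMr//; apply: le_trans (ltW ne).
      rewrite lef_pV2 ?posrE ?exprn_gt0// -natrX ler_nat.
      by rewrite (leq_trans _ (ltnW (ltn_expl _ _))).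
    exists (scale k.+2); split.
      rewrite scale_gt0/=; apply: le_trans (scale_le _) _.
      by rewrite ler_peMl// ltW.
    set r := scale k.+2 in kW *.
    have r0 : (0 < r)%R by exact: scale_gt0.
    have rk : scale k = (2 * (2 * r))%R by rewrite /r !scaleS.
    apply: (@le_trans _ _ (mu (E `&` ball x (scale k)))).
      apply: le_measure; rewrite ?inE.
      - by apply: measurableI => //; exact: ball_borel.
      - by apply: measurableI => //; exact: ball_borel.
      - by move=> z [[Ez _] xz]; split => //; apply: le_ball xz; rewrite rk; lra.
    apply: (le_trans (ndx k)).
    have krho := scale_le k.
    apply: (@le_trans _ _ (c%:E * (D%:E * (D%:E * mu (ball x r))))).
      rewrite lee_pmul2l// rk.
      apply: (@le_trans _ _ (D%:E * mu (ball x (2 * r)%R))).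
        by apply: doubling; [lra|apply: le_trans rho_m; lra].
      by rewrite lee_pmul2l//; apply: doubling => //; apply: le_trans rho_m; lra.
    have cDD : (c * (D * D) = 1 / 2)%R by rewrite -expr2.
    rewrite !muleA -!EFinM -mulrA cDD intphi; last exact: ball_borel.
    rewrite -[leLHS]adde0 -addeA; apply: leeD.
      by rewrite setIidl.
    by rewrite adde_ge0// mule_ge0 ?integral_ge0 ?lee_fin ?(ltW K0)// => y _;
      exact: lip_ge0.
have /choice[r rP] : forall x, exists r : R, A x -> (0 < r <= lambda * rho)%R /\
    mu (A `&` ball x (3 * r)%R) <= \int[mu]_(y in (ball x r : set (borel X))) phi y.
  by move=> x; have [/pointwise[r rx]|nAx] := pselect (A x); [exists r|exists 0%R].
have := covering_comparison Xmms.1 mA mphi phi0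
  (fun x Ax => (rP x Ax).1) (fun x Ax => (rP x Ax).2).
rewrite intphi// !setTI => Aphi.
have cheb (S : set X) : measurable (S : set (borel X)) -> S `<=` V ->
    (forall y, S y -> (1 / 2)%:E <= w y) -> (1 / 2)%:E * mu S <= eps%:E.
  move=> mS SV Sw; apply: le_trans w_eps.
  by apply: measure_le_integral => //; exact: subset_trans VV'.
have chebE : (1 / 2)%:E * mu (E `&` V `\` U) <= eps%:E.
  apply: cheb.
  - by apply: measurableD => //; exact: measurableI.
  - by move=> y [[]].
  - move=> y [[Ey _] /negP]; rewrite -leNgt => uy.
    have E1 : \1_E y = 1%R :> R by rewrite indicE mem_set.
    rewrite /w lee_fin E1 ler_normr; apply/orP; right; lra.
have chebU : (1 / 2)%:E * mu ((U `&` V) `\` E) <= eps%:E.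
  apply: cheb.
  - by apply: measurableD => //; exact: measurableI.
  - by move=> y [[]].
  - move=> y [[/= uy _] nEy].
    have E0 : \1_E y = 0%R :> R by rewrite indicE memNset.
    rewrite /w lee_fin E0 ler_normr; apply/orP; left; have : (1 / 2 < u y)%R := uy; lra.
have fin (S : set X) : measurable (S : set (borel X)) -> S `<=` V ->
    exists a : R, mu S = a%:E.
  move=> mS SV; exists (fine (mu S)); rewrite fineK// ge0_fin_numE//.
  by apply: le_lt_trans (finite_measure_ball Xmms x0 N); apply: le_measure; rewrite ?inE.
have mEV : measurable (E `&` V : set (borel X)) by exact: measurableI.
have mEVU : measurable ((E `&` V) `\` U : set (borel X)) by exact: measurableD.
have mWE : measurable ((U `&` V) `\` E : set (borel X)) by exact: measurableD.
have [a aE] := fin _ mEV (@subIsetr _ _ _).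
have [b bE] : exists b : R, mu A = b%:E by apply: fin => // y [_ []].
have [d1 d1E] : exists b : R, mu (E `&` V `\` U) = b%:E by apply: fin => // y [[]].
have [d2 d2E] : exists b : R, mu ((U `&` V) `\` E) = b%:E by apply: fin => // y [[]].
have [e eE] : exists b : R, mu (U `&` V) = b%:E by apply: fin => // y [].
have [om omE] : exists om : R, \int[mu]_(y in (V' : set (borel X))) w y = om%:E.
  exists (fine (\int[mu]_(y in (V' : set (borel X))) w y)); rewrite fineK//.
  by rewrite ge0_fin_numE ?integral_ge0//; apply: le_lt_trans w_eps _; exact: ltry.
have [j jE] : exists j : R, \int[mu]_(y in [set: borel X]) lip u y = j%:E.
  exists (fine (\int[mu]_(y in [set: borel X]) lip u y)); rewrite fineK//.
  rewrite ge0_fin_numE ?integral_ge0//; last by move=> y _; exact: lip_ge0.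
  by apply: le_lt_trans lipJ _; exact: ltry.
rewrite bE eE omE jE -!EFinM -!EFinD lee_fin in Aphi.
rewrite d1E -EFinM lee_fin in chebE; rewrite d2E -EFinM lee_fin in chebU.
rewrite omE lee_fin in w_eps; rewrite jE lee_fin in lipJ.
have ab : (a <= b + d1)%R.
  rewrite -lee_fin EFinD -aE -bE -d1E.
  apply: le_trans (measureU2 _ _ _) => //; apply: le_measure; rewrite ?inE//.
    exact: measurableU.
  by move=> y [Ey Vy]; have [Uy|nUy] := pselect (U y); [left|right].
have ea : (e <= a + d2)%R.
  rewrite -lee_fin EFinD -aE -eE -d2E.
  apply: le_trans (measureU2 _ _ _) => //; apply: le_measure; rewrite ?inE//.
    exact: measurableU.
  by move=> y [Uy Vy]; have [Ey|nEy] := pselect (E y); [left|right].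
have LJ : (L * j <= L * J)%R by rewrite ler_wpM2l.
have Kom : (K * om <= K * eps)%R by rewrite ler_pM2l.
rewrite aE lee_fin.
have -> : (2 * (K + 3) * eps + 2 * K * CP * M * J =
    2 * (K * eps) + 6 * eps + 2 * (L * J))%R.
  by rewrite /L; ring.
lra.
Qed.

End one_approximation.

(** * Passage to the limit *)

Lemma limn_einf_lt_frequently (R : realType) (a : (\bar R)^nat) (b : \bar R) :
  limn_einf a < b -> forall n, exists2 i, (n <= i)%N & a i < b.
Proof.
move=> ab n; apply: contrapT => nex.
move: ab; rewrite ltNge => /negP; apply.
rewrite limn_einf_lim; apply: lime_ge; first exact: is_cvg_einfs.
near=> k; apply: le_ereal_inf_tmp => _ [i /= ki <-].
rewrite leNgt; apply/negP => ai; apply: nex; exists i => //.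
by apply: leq_trans ki; near: k; exists n.
Unshelve. all: by end_near. Qed.

Lemma measure_le_of_balls (R : realType) (X : completeMetricType R)
    (mu : {measure set (borel X) -> \bar R}) (E : set X) (x0 : X) (a : \bar R) :
  measurable (E : set (borel X)) ->
  (forall n : nat, mu (E `&` ball x0 n%:R) <= a) -> mu E <= a.
Proof.
move=> mE Ea.
have EE : E = \bigcup_n (E `&` ball x0 n%:R).
  rewrite -setI_bigcupr setIidl// => y _.
  exists (Num.trunc (mdist x0 y)).+1 => //.
  by rewrite ballEmdist /=; exact: truncnS_gt.
have mEn n : measurable (E `&` ball x0 n%:R : set (borel X)).
  by apply: measurableI => //; exact: ball_borel.
have cv : (mu \o (fun n => E `&` ball x0 n%:R)) @ \oo --> mu E.
  rewrite [in X in _ --> X]EE; apply: nondecreasing_cvg_mu => //.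
    by rewrite -EE.
  move=> i j ij; apply/subsetPset; apply: setIS; apply: le_ball.
  by rewrite ler_nat.
by apply: cvge_le cv; apply: nearW.
Qed.

Theorem proposition3p19 (R : realType) (X : completeMetricType R)
    (mu : {measure set (borel X) -> \bar R}) (s : R)
    (Xmms : metric_measure_space mu) (s1 : (1 < s)%R)
    (ahlfors : uniformly_lower_Ahlfors_regular mu s)
    (doubling : uniformly_locally_doubling mu)
    (poincare : weak_local_poincare mu) :
  exists C v : R, [/\ (0 < C)%R, (0 < v)%R &
    forall E : set X, finite_perimeter mu E ->
      mu E <= v%:E -> mu E `^ ((s - 1) / s) <= C%:E * perimeter mu E].
Proof.
have [rho [C0 [rho0 C00 ahl]]] := ahlfors.
have [lambda lambda1 P] := poincare.
have [CP CP0 {}P] := P _ (mulr_gt0 (ltr0Sn _ 1) rho0).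
have [m m_lambda] : exists m : nat, (3 * lambda <= 2 ^+ m :> R)%R.
  exists (Num.trunc (3 * lambda)%R).+1.
  apply: (le_trans (ltW (truncnS_gt _))); rewrite -natrX ler_nat.
  exact: ltnW (ltn_expl _ _).
have m_rho : (0 < 2 ^+ m * rho)%R by rewrite mulr_gt0// exprn_gt0.
have [D' D'0 dbl'] := doubling _ m_rho.
pose D := Num.max 1%R D'.
have D1 : (1 <= D)%R by rewrite le_max lexx.
have D0 : (0 < D)%R by apply: lt_le_trans D1.
have dbl (x : X) (r : R) : (0 < r)%R -> (r <= 2 ^+ m * rho)%R ->
    mu (ball x (2 * r)%R) <= D%:E * mu (ball x r).
  move=> r0 rm; apply: (le_trans (dbl' _ _ r0 rm)).
  by rewrite lee_wpmul2r// lee_fin le_max lexx orbT.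
have s0 : (0 < s)%R by apply: lt_trans s1.
have poin (u : X -> R) : locally_lipschitz u ->
  forall (x : X) (r : R), (0 < r)%R -> (r <= rho)%R -> exists a : R,
    \int[mu]_(y in (ball x r : set (borel X))) `|u y - a|%:E <=
      (CP * r)%:E *
      \int[mu]_(y in (ball x (lambda * r)%R : set (borel X))) lip u y.
  move=> uL x r r0 rrho; exists (ball_average mu u x r).
  apply: P => //; [exact: locally_lipschitz_L1loc|exact: lip_upper_gradient|lra].
pose c := ((2 * D ^+ 2)^-1)%R.
have c0 : (0 < c)%R by rewrite invr_gt0 mulr_gt0// exprn_gt0.
pose K := (D ^+ m * (D / c))%R.
have K0 : (0 < K)%R by rewrite mulr_gt0 ?exprn_gt0 // divr_gt0.
pose kappa := ((D / (c * C0)) `^ s^-1)%R.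
have kappa0 : (0 < kappa)%R by rewrite powR_gt0// divr_gt0// mulr_gt0.
have KCP0 : (0 < 2 * K * CP)%R by apply: mulr_gt0 => //; exact: mulr_gt0.
have Cst0 : (0 < 2 * K * CP * kappa)%R by exact: mulr_gt0.
have cCr : (0 < c * (C0 * rho `^ s))%R by rewrite !mulr_gt0// powR_gt0.
exists (2 * K * CP * kappa)%R, (c * (C0 * rho `^ s) / 2)%R; split.
- exact: Cst0.
- by rewrite divr_gt0.
move=> E [measE _] Ev.
have [mE muE] : exists mE : R, mu E = mE%:E.
  exists (fine (mu E)); rewrite fineK// ge0_fin_numE//.
  by apply: le_lt_trans Ev _; exact: ltry.
have mE0 : (0 <= mE)%R by rewrite -lee_fin -muE.
have mE_small : (mE < c * (C0 * rho `^ s))%R.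
  by move: Ev; rewrite muE lee_fin; lra.
rewrite muE poweR_EFin.
rewrite -lee_pdivrMl; last exact: Cst0.
apply: le_ereal_inf_tmp => _ [u_ [uL cvu ->]].
set p := limn_einf _.
rewrite lee_pdivrMl; last exact: Cst0.
have p0 : 0 <= p.
  rewrite /p limn_einf_lim; apply: lime_ge; first exact: is_cvg_einfs.
  apply: nearW => n; apply: le_ereal_inf_tmp => _ [i _ <-].
  by apply: integral_ge0 => x _; exact: lip_ge0.
have [pf|] := boolP (p \is a fin_num); last first.
  rewrite ge0_fin_numE// -leNgt leye_eq => /eqP ->.
  by rewrite gt0_muley ?leey// lte_fin Cst0.
pose q := fine p.
have q0 : (0 <= q)%R by exact: fine_ge0.
rewrite -(fineK pf) -/q -EFinM lee_fin.
have [->|mE_neq0] := eqVneq mE 0%R.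
  rewrite powR0; first by rewrite mulr_ge0// ltW.
  by rewrite mulf_neq0 ?invr_neq0 ?gt_eqF// subr_gt0.
have mE_gt0 : (0 < mE)%R by rewrite lt_neqAle eq_sym mE_neq0.
pose M := ((D / (c * C0) * mE) `^ s^-1)%R.
have ME : M = (kappa * mE `^ s^-1)%R by rewrite /M powRM// ltW// divr_gt0// mulr_gt0.
have M0 : (0 < M)%R by rewrite ME mulr_gt0// powR_gt0.
have x0 : X := point.
have bound : (mE <= 2 * K * CP * M * q)%R.
  rewrite -lee_fin -muE; apply: (@measure_le_of_balls _ _ mu E x0) => // n.
  apply/lee_addgt0Pr => e e0.
  pose T := (2 * (K + 3) + 2 * K * CP * M)%R.
  have T0 : (0 < T)%R.
    by rewrite addr_gt0//; [rewrite mulr_gt0// addr_gt0|exact: mulr_gt0].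
  pose d := (e / T)%R.
  have d0 : (0 < d)%R by rewrite divr_gt0.
  have cvw := cvg_L1loc_ball Xmms ahlfors (measurable_indic measE)
    (fun i => continuous_borel (locally_lipschitz_continuous (uL i))) cvu x0
    (n%:R + rho)%R.
  have [i0 _ wi0] : \forall i \near \oo,
    \int[mu]_(y in (ball x0 (n%:R + rho)%R : set (borel X)))
      `|u_ i y - \1_E y|%:E <= d%:E.
    have d_nbhs : nbhs (0 : \bar R) [set x | x < d%:E].
      by apply: open_nbhs_nbhs; split; [exact: open_ereal_lt_ereal|rewrite /= lte_fin].
    have w_lt : \forall i \near \oo,
        \int[mu]_(y in (ball x0 (n%:R + rho)%R : set (borel X)))
          `|u_ i y - \1_E y|%:E < d%:E := cvw _ d_nbhs.
    by apply: filterS w_lt => i /ltW.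
  have p_lt : p < (q + d)%:E by rewrite -(fineK pf) lte_fin ltrDl.
  have [i i0i lipi] := limn_einf_lt_frequently p_lt i0.
  apply: (le_trans (localized_isoperimetric_estimate Xmms s0 rho0 C00 D1
    lambda1 CP0 m_lambda ahl dbl poin measE muE mE_small (uL i) (wi0 _ i0i)
    (ltW lipi))).
  rewrite -EFinD lee_fin -/c -/K -/M.
  have eT : e = (T * d)%R by rewrite mulrC divfK// gt_eqF.
  by rewrite [in leRHS]eT le_eqVlt; apply/orP; left; apply/eqP; rewrite /T; ring.
(* Dividing the bound by mu(E)^(1/s). *)
have sE : (mE = mE `^ s^-1 * mE `^ ((s - 1) / s))%R.
  rewrite -powRD; last by rewrite mE_neq0 implybT.
  rewrite (_ : (s^-1 + (s - 1) / s = 1)%R) ?powRr1//.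
  by field; rewrite gt_eqF.
have a0 : (0 < mE `^ s^-1)%R by rewrite powR_gt0.
rewrite -(ler_pM2l a0) -sE; apply: (le_trans bound); rewrite ME.
by rewrite le_eqVlt; apply/orP; left; apply/eqP; ring.
Qed.
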